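(* Let $G$ be a countable group, let $\mathrm{ZR}_*(G)$ denote either $\mathrm{ZR}_l(G)$ or $\mathrm{ZR}(G)$, and let $\mathcal G=(\mathcal G_n)_{n\geq 1}$ be a chain $\mathcal G_1\subset\mathcal G_2\subset\cdots$ of finite subsets of $G$ with $\bigcup_{n\geq 1}\mathcal G_n=G$. Then: (i) the function $d_{\mathcal G}$ is an ultrametric on $\mathrm{ZR}_*(G)$; (ii) the topology defined on $\mathrm{ZR}_*(G)$ by $d_{\mathcal G}$ is the Patch topology. In particular, it does not depend on the choice of $\mathcal G$.
   Context: A left-invariant preorder on a group $G$ is a binary relation $\preceq$ on $G$ that is total ($u\preceq v$ or $v\preceq u$ for all $u,v\in G$), transitive, and such that $u\preceq v$ implies $wu\preceq wv$ for all $u,v,w\in G$. It is bi-invariant if in addition $u\preceq v$ implies $uw\preceq vw$. $\mathrm{ZR}_l(G)$ is the set of left-invariant preorders on $G$ and $\mathrm{ZR}(G)$ the set of bi-invariant ones. Write $u\prec v$ if $u\preceq v$ and not $v\preceq u$. The Patch topology on $\mathrm{ZR}_*(G)$ is the topology generated by the sets $\mathcal O_u=\{\preceq\mid u\succeq 1\}$ and $\mathcal U_u=\{\preceq\mid u\succ 1\}$, $u\in G$. For $\preceq_1\neq\preceq_2$ in $\mathrm{ZR}_*(G)$, set $d_{\mathcal G}(\preceq_1,\preceq_2)=\frac1n$, where $n\geq 1$ is the integer such that the restrictions of $\preceq_1$ and $\preceq_2$ (as binary relations) to $\mathcal G_{n-1}$ are equal but their restrictions to $\mathcal G_n$ are different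 (with $\mathcal G_0=\emptyset$); set $d_{\mathcal G}(\preceq,\preceq)=0$. *)

(* Defs.v *)
From HB Require Import structures.
From mathcomp Require Import all_boot all_order all_algebra.
From mathcomp Require Import all_classical all_reals all_analysis.

Set Implicit Arguments.
Unset Strict Implicit.
Unset Printing Implicit Defensive.
Import Order.TTheory GRing.Theory Num.Theory.
Local Open Scope classical_set_scope.
Local Open Scope ring_scope.

(* [Left] selects ZR_l(G) and [Bi] selects ZR(G). *)
Inductive sidedness := Left | Bi.

Section Preorders.
Context (G : groupType).
Implicit Type r : rel G.

Definition left_invariant r := forall u v w, r u v -> r (w * u)%g (w * v)%g.

Definition right_invariant r := forall u v w, r u v -> r (u * w)%g (v * w)%g.

Definition left_invariant_preorder r :=
  [/\ total r, transitive r & left_invariant r].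

Definition bi_invariant_preorder r :=
  left_invariant_preorder r /\ right_invariant r.

Definition invariant_preorder (s : sidedness) r : Prop :=
  match s with
  | Left => left_invariant_preorder r
  | Bi => bi_invariant_preorder r
  end.

Definition strict r : rel G := fun u v => r u v && ~~ r v u.

End Preorders.

(* The asserted property is reified as a boolean so that it is
   proof-irrelevant: two elements of [ZR] are equal as soon as the underlying
   relations are (see [val_inj]). *)
Record ZR (s : sidedness) (G : groupType) := MkZR {
  preceq :> rel G;
  preceqP : `[< invariant_preorder s preceq >] }.

HB.instance Definition _ s (G : groupType) := [isSub for @preceq s G].
HB.instance Definition _ s (G : groupType) := [Choice of ZR s G by <:].

Section Patch.
Context (s : sidedness) (G : groupType).

Definition patch_O (u : G) : set (ZR s G) := [set p | preceq p 1%g u].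

Definition patch_U (u : G) : set (ZR s G) := [set p | strict (preceq p) 1%g u].

(* The library's [open] on [ZR s G] is thereby the Patch topology; the subbase
   is indexed by its own members. *)
HB.instance Definition _ := isSubBaseTopological.Build (ZR s G)
  (range patch_O `|` range patch_U) (id : set (ZR s G) -> set (ZR s G)).

End Patch.

Section Distance.
Context (G : groupType).

(* Only the values of [Gs] at indices n >= 1 are meaningful. *)
Definition exhausting_chain (Gs : nat -> set G) :=
  [/\ forall n, (1 <= n)%N -> finite_set (Gs n),
      forall n, (1 <= n)%N -> Gs n `<=` Gs n.+1
    & \bigcup_(n in [set n | (1 <= n)%N]) Gs n = [set: G]].

(* The chain extended by the convention that its 0-th term is empty. *)
Definition level (Gs : nat -> set G) (n : nat) : set G :=
  if n is 0%N then set0 else Gs n.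

Definition agree_on (A : set G) (p q : rel G) :=
  forall u v, A u -> A v -> p u v = q u v.

Definition separation_index (Gs : nat -> set G) (p q : rel G) : set nat :=
  [set n | [/\ (1 <= n)%N, agree_on (level Gs n.-1) p q
             & ~ agree_on (level Gs n) p q]].

(* For an exhausting chain and p <> q, [separation_index Gs p q] is a
   singleton, so the default value 0 of [xget] is never used. *)
Definition chain_dist (R : realType) (s : sidedness) (Gs : nat -> set G)
    (p q : ZR s G) : R :=
  if p == q then 0 else (xget 0%N (separation_index Gs p q))%:R^-1.

End Distance.
Arguments chain_dist {G} R s Gs p q.

Section Metric.
Context (R : realType) (T : Type) (d : T -> T -> R).

Definition is_ultrametric :=
  [/\ forall x y, 0 <= d x y,
      forall x y, d x y = 0 <-> x = y,
      forall x y, d x y = d y x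
    & forall x y z, d x z <= Num.max (d x y) (d y z)].

Definition metric_topology : set (set T) :=
  [set A | forall x, A x -> exists2 e : R, 0 < e & [set y | d x y < e] `<=` A].

End Metric.

(* Main.v *)
Require Import Defs.
From mathcomp Require Import all_boot all_order all_algebra.
From mathcomp Require Import all_classical all_reals all_analysis.
Import Order.TTheory GRing.Theory Num.Theory.
Local Open Scope classical_set_scope.

(** By definition [d] takes its values in [{0} U {1/n}], and
    [d p q < 1/n] holds exactly when [p] and [q] coincide on the [n]-th set of
    the chain ([chain_dist_lt]).  Both parts of the theorem are read off from
    this.

    For the ultrametric inequality: coinciding on a given set is an
    equivalence relation, so the balls of radius [1/n] are the classes of an
    equivalence relation, and a distance is bounded by [e] as soon as the two
    preorders coincide on all the sets of the chain of index [n] with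
    [e < 1/n] ([chain_dist_le]).  Separation holds because the chain exhausts
    the group.

    For the topology: left invariance reduces the comparison of [u] and [v] to
    that of [1] and [u^-1 * v].  By totality the two truth values of [u <= v]
    thus define a member of each of the two families of subbasic sets
    ([open_agree1]).  Coinciding with [p] on a finite set is a finite
    conjunction of such conditions, so balls are Patch neighbourhoods of their
    centre ([nbhs_agree]).  Conversely a subbasic set only constrains the
    comparison of [1] and [u], and both points lie in some set of the chain;
    a basic set constrains finitely many such pairs ([finite_depth]).  Finally
    the Patch topology is defined without a chain, whence the independence. *)

(** * Exhausting chains *)

Section Chain.
Context {G : groupType} {Gs : nat -> set G}.
Context (chainGs : exhausting_chain Gs).

Lemma chain_subset {m n} : (m <= n)%N -> Gs m.+1 `<=` Gs n.+1.
Proof.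
case: chainGs => _ incr _.
apply: (@homo_leq _ (fun n => Gs n.+1) (fun A B => A `<=` B)) => [A|B A C|i].
- exact: subset_refl.
- exact: subset_trans.
- exact: incr.
Qed.

Lemma chain_cover u : exists n, Gs n.+1 u.
Proof.
case: chainGs => _ _ cover.
have : [set: G] u by [].
by rewrite -cover => -[[|n] //= _ Gnu]; exists n.
Qed.

Lemma agree_onS {A B : set G} {p q : rel G} :
  A `<=` B -> agree_on B p q -> agree_on A p q.
Proof. by move=> AB pq u v Au Av; apply: pq; apply: AB. Qed.

Lemma agree_chainS {m n} {p q : rel G} : (m <= n)%N ->
  agree_on (Gs n.+1) p q -> agree_on (Gs m.+1) p q.
Proof. by move=> mn; apply/agree_onS/chain_subset. Qed.

Lemma agree_chain_eq {s} (p q : ZR s G) :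
  (forall n, agree_on (Gs n.+1) p q) -> p = q.
Proof.
move=> pq; apply: val_inj; apply/funext => u; apply/funext => v.
have [m Gmu] := chain_cover u; have [n Gnv] := chain_cover v.
apply: (pq (maxn m n)).
- exact: chain_subset (leq_maxl _ _) _ Gmu.
- exact: chain_subset (leq_maxr _ _) _ Gnv.
Qed.

Lemma separation_index_ex {s} {p q : ZR s G} :
  p <> q -> exists n, separation_index Gs p q n.
Proof.
move=> pNq.
have exN : exists n, `[< ~ agree_on (Gs n.+1) p q >].
  apply: contra_notP pNq => noN; apply: agree_chain_eq => n.
  by apply: contrapT => ?; apply: noN; exists n; apply/asboolP.
case: (ex_minnP exN) => n /asboolP nN minN; exists n.+1; split => //=.
case: n {nN} minN => [|n] minN; first by move=> u v [].
by apply: contrapT => /asboolP/minN; rewrite ltnn.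
Qed.

(** * The distance *)

Section Dist.
Context {R : realType} {s : sidedness}.
Implicit Types p q : ZR s G.
Local Notation d := (chain_dist R s Gs).

Lemma chain_distxx p : d p p = 0%R.
Proof. by rewrite /chain_dist eqxx. Qed.

Lemma chain_dist_neq {p q} : p <> q ->
  exists n, [/\ d p q = n.+1%:R^-1%R, agree_on (level Gs n) p q
              & ~ agree_on (Gs n.+1) p q].
Proof.
move=> pNq; rewrite /chain_dist; case: eqP => // _.
have := xgetPex 0%N (separation_index_ex pNq).
by case: (xget _ _) => [|n] [] // _ lo hi; exists n.
Qed.

Lemma chain_dist_lt {n p q} :
  (d p q < n.+1%:R^-1)%R <-> agree_on (Gs n.+1) p q.
Proof.
have [<-|pNq] := pselect (p = q).
  by rewrite chain_distxx invr_gt0 ltr0n.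
have [m [-> lo hi]] := chain_dist_neq pNq.
rewrite ltf_pV2 ?posrE ?ltr0n// ltr_nat ltnS; split.
  by case: m lo {hi} => // m lo; rewrite ltnS => nm; apply: agree_chainS lo.
move=> pq; rewrite ltnNge; apply/negP => mn.
exact: hi (agree_chainS mn pq).
Qed.

Lemma chain_dist_ge0 p q : (0 <= d p q)%R.
Proof. by rewrite /chain_dist; case: eqP => // _; rewrite invr_ge0 ler0n. Qed.

(** The values of the distance being [0] and the [1/n], the distance of two
    points is determined by the balls of radius [1/n]. *)
Lemma chain_dist_le {e : R} {p q} : (0 <= e)%R ->
  (forall n, (e < n.+1%:R^-1)%R -> agree_on (Gs n.+1) p q) -> (d p q <= e)%R.
Proof.
move=> e0 pq; have [<-|pNq] := pselect (p = q); first by rewrite chain_distxx.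
have [m [-> _ hi]] := chain_dist_neq pNq.
by rewrite leNgt; apply/negP => /pq.
Qed.

Lemma chain_dist_sym p q : d p q = d q p.
Proof.
have le x y : (d x y <= d y x)%R.
  apply: chain_dist_le; first exact: chain_dist_ge0.
  by move=> n /chain_dist_lt yx u v Au Av; rewrite yx.
by apply/eqP; rewrite eq_le !le.
Qed.

Lemma chain_dist_ultrametric : is_ultrametric d.
Proof.
split.
- exact: chain_dist_ge0.
- move=> p q; split=> [pq0|<-]; last exact: chain_distxx.
  by apply: agree_chain_eq => n; apply/chain_dist_lt; rewrite pq0 invr_gt0 ltr0n.
- exact: chain_dist_sym.
- move=> p q r; apply: chain_dist_le; first by rewrite le_max chain_dist_ge0.
  move=> n; rewrite gt_max => /andP[/chain_dist_lt pq /chain_dist_lt qr] u v Au Av.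
  by rewrite pq ?qr.
Qed.

(** Every positive radius exceeds some [1/n], so the balls of radius [1/n]
    suffice to test openness. *)
Lemma metric_topologyP (A : set (ZR s G)) : metric_topology d A <->
  forall p, A p -> exists n, forall q, agree_on (Gs n.+1) p q -> A q.
Proof.
split=> metA p /metA.
  case=> e e0 ball; have [n] := ltr_add_invr e0; rewrite add0r => ne.
  by exists n => q /chain_dist_lt pq; apply: ball => /=; apply: lt_trans pq ne.
case=> n ball; exists n.+1%:R^-1%R; first by rewrite invr_gt0 ltr0n.
by move=> q /chain_dist_lt; apply: ball.
Qed.

End Dist.
End Chain.

(** * The Patch topology *)

Section Patch.
Context {s : sidedness} {G : groupType}.
Implicit Types p q : ZR s G.

Lemma ZR_left p : left_invariant_preorder p.
Proof. by case: p => r /= /asboolP; case: s => [|[]]. Qed.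

Lemma preceq_translate p u v : preceq p u v = preceq p 1%g (u^-1 * v)%g.
Proof.
have [_ _ inv] := ZR_left p.
apply/idP/idP => [/(inv _ _ u^-1%g)|/(inv _ _ u)]; first by rewrite mulVg.
by rewrite mulg1 mulVKg.
Qed.

Lemma preceq_strictN p u v : strict p u v = ~~ preceq p v u.
Proof.
have [tot _ _] := ZR_left p.
rewrite /strict; have := tot u v.
by case: (preceq p v u); rewrite (andbF, orbF) // => ->.
Qed.

Lemma open_patch_O u : open (patch_O u : set (ZR s G)).
Proof.
exists [set patch_O u]; last by rewrite bigcup_set1.
by move=> _ ->; apply: (@finI_from1 _ _ _ id); left; exists u.
Qed.

Lemma open_patch_U u : open (patch_U u : set (ZR s G)).
Proof.
exists [set patch_U u]; last by rewrite bigcup_set1.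
by move=> _ ->; apply: (@finI_from1 _ _ _ id); right; exists u.
Qed.

(** If [u <= v] in [p], the condition is [1 <= u^-1 * v]; otherwise it is
    [v < u] by totality, that is [1 < v^-1 * u]. *)
Lemma open_agree1 p u v : open [set q : ZR s G | preceq p u v = preceq q u v].
Proof.
case: (preceq p u v).
  rewrite [X in open X](_ : _ = patch_O (u^-1 * v)%g); first exact: open_patch_O.
  by apply/seteqP; split=> q; rewrite /patch_O/= -preceq_translate.
rewrite [X in open X](_ : _ = patch_U (v^-1 * u)%g); first exact: open_patch_U.
apply/seteqP; split=> q; rewrite /patch_U/= preceq_strictN;
  rewrite (preceq_translate q (_ * _)%g) invgM invgK mulg1 -preceq_translate.
- by move=> <-.
- by move/negbTE.
Qed.

Lemma nbhs_agree {A : set G} p : finite_set A ->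
  nbhs p [set q : ZR s G | agree_on A p q].
Proof.
move=> finA; have /finite_fsetP[X AX] := finite_setX finA finA.
have : nbhs p (\bigcap_(w in A `*` A)
    [set q : ZR s G | preceq p w.1 w.2 = preceq q w.1 w.2]).
  rewrite AX; apply: filter_bigI => w _; apply: open_nbhs_nbhs; split=> //.
  exact: open_agree1.
apply: filterS => q pq u v Au Av.
exact: (pq (u, v)).
Qed.

Context {Gs : nat -> set G}.
Context (chainGs : exhausting_chain Gs).

Lemma subbase_depth {p} {B : set (ZR s G)} :
  (range (@patch_O s G) `|` range (@patch_U s G)) B -> B p ->
  exists n, forall q, agree_on (Gs n.+1) p q -> B q.
Proof.
have [m Gm1] := chain_cover chainGs 1%g.
have pair_depth u : exists n, Gs n.+1 1%g /\ Gs n.+1 u.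
  have [n Gnu] := chain_cover chainGs u; exists (maxn m n); split.
  - exact: chain_subset (leq_maxl _ _) _ Gm1.
  - exact: chain_subset (leq_maxr _ _) _ Gnu.
case=> -[u _ <-] Bp; have [n [Gn1 Gnu]] := pair_depth u; exists n => q pq.
- by move: Bp; rewrite /patch_O/= pq.
- by move: Bp; rewrite /patch_U/= !preceq_strictN pq.
Qed.

(** Depths of finitely many conditions have a maximum, and agreement on a set
    of the chain implies agreement on the earlier ones. *)
Lemma finite_depth p (Bs : seq (set (ZR s G))) :
  (forall B, B \in Bs -> exists n, forall q, agree_on (Gs n.+1) p q -> B q) ->
  exists n, forall q, agree_on (Gs n.+1) p q -> forall B, B \in Bs -> B q.
Proof.
elim: Bs => [_|B Bs IH depth]; first by exists 0%N.
have [|m Bsm] := IH; first by move=> C CBs; apply: depth; rewrite inE CBs orbT.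
have [|n Bn] := depth B; first exact: mem_head.
exists (maxn m n) => q pq C; rewrite inE => /orP[/eqP->|CBs].
- exact/Bn/(agree_chainS chainGs (leq_maxr m n)).
- exact: Bsm (agree_chainS chainGs (leq_maxl m n) pq) _ CBs.
Qed.

Lemma metric_topology_patch (R : realType) :
  metric_topology (chain_dist R s Gs) = [set A : set (ZR s G) | open A].
Proof.
apply/seteqP; split=> A.
  move=> /(metric_topologyP chainGs) metA; rewrite /= openE => p /metA[n ball].
  case: chainGs => finGs _ _.
  by apply: filterS (nbhs_agree _ (finGs n.+1 isT)).
case=> basics basic <-; apply/(metric_topologyP chainGs) => p [C basicsC Cp].
have [Bs subBs BsC] := basic C basicsC; move: Cp; rewrite -BsC => Bsp.
have [B BBs|n ball] := @finite_depth p (finmap.enum_fset Bs).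
  by apply: (subbase_depth _ (Bsp B BBs)); apply/set_mem/subBs.
by exists n => q pq; exists C => //; rewrite -BsC; apply: ball.
Qed.

End Patch.

Theorem proposition2p65 (R : realType) (G : groupType) (s : sidedness)
    (Gs : nat -> set G) (countG : countable [set: G])
    (chainGs : exhausting_chain Gs) :
  is_ultrametric (chain_dist R s Gs) /\
  metric_topology (chain_dist R s Gs) = [set A : set (ZR s G) | open A] /\
  (forall Gs' : nat -> set G, exhausting_chain Gs' ->
     metric_topology (chain_dist R s Gs') = metric_topology (chain_dist R s Gs)).
Proof.
split; first exact: chain_dist_ultrametric.
split; first exact: metric_topology_patch.
by move=> Gs' chainGs'; rewrite !metric_topology_patch.
Qed.
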